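(* Let $f:\mathbb{R}^d\to\mathbb{R}$ be Lipschitz-smooth with constant $L>0$ and strongly convex with constant $m>0$, with minimizer $x^\ast$. Consider gradient descent $x_{k+1}=x_k-\alpha_k\nabla f(x_k)$, $k\ge0$, whose step-sizes $\alpha_k$ are chosen by adaptive backtracking (ABLS) for the Armijo condition with $c\in[1/2,1)$ and initial step-size $\alpha_{\mathrm{in}}\in(0,1/m)$. Put $\overline\alpha=2(1-c)/L$. Then for all $k\ge0$ $$f(x_k)-f(x^\ast)\le\bigl(1-m\min\{\alpha_{\mathrm{in}},\rho\overline\alpha\}\bigr)^k\,\frac{L+m}{2}\,\|x_0-x^\ast\|^2 .$$ In particular, if $c=1/2$ and $\alpha_{\mathrm{in}}>\rho/L$, then $$f(x_k)-f(x^\ast)\le(1-\rho q)^k\,\frac{L+m}{2}\,\|x_0-x^\ast\|^2,\qquad q=m/L .$$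
   Context: A differentiable $f$ is Lipschitz-smooth with constant $L>0$ if $f(y)\le f(x)+\langle\nabla f(x),y-x\rangle+\frac L2\|y-x\|^2$ for all $x,y$. A continuously differentiable $f$ is strongly convex with constant $m>0$ if $f(y)\ge f(x)+\langle\nabla f(x),y-x\rangle+\frac m2\|y-x\|^2$ for all $x,y$. ABLS has parameters $c$ and $0<\epsilon<\rho<1$. At $x_k$ with direction $d_k=-\nabla f(x_k)$, the Armijo condition for $\alpha>0$ is $f(x_k+\alpha d_k)-f(x_k)\le c\,\alpha\langle\nabla f(x_k),d_k\rangle$; when $\nabla f(x_k)\ne0$ it is equivalent to $v(\alpha)\ge1$ with $v(\alpha)=\frac{f(x_k+\alpha d_k)-f(x_k)}{c\,\alpha\langle\nabla f(x_k),d_k\rangle}$ (it holds trivially when $\nabla f(x_k)=0$). ABLS at iteration $k$: start from an initial tentative $\alpha$; while the Armijo condition fails, set $\alpha\gets\hat\rho(v(\alpha))\,\alpha$, where $\hat\rho(v(\alpha))=\max\bigl(\epsilon,\rho\frac{1-c}{1-c\,v(\alpha)}\bigr)$; return $\alpha_k=\alpha$. The initial tentative step-size is $\alpha_{\mathrm{in}}$ at every iteration (memoryless), or $\alpha_{\mathrm{in}}$ at iteration $0$ and $\alpha_{k-1}$ at iteration $k\ge1$ (monotone). *)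

(* Defs.v *)
From HB Require Import structures.
From mathcomp Require Import all_boot all_order all_algebra.
From mathcomp Require Import all_classical all_reals all_analysis.

Set Implicit Arguments.
Unset Strict Implicit.
Unset Printing Implicit Defensive.

Import Order.TTheory GRing.Theory Num.Theory.
Import numFieldNormedType.Exports.

Local Open Scope ring_scope.

Definition dot (R : realType) (d : nat) (u v : 'rV[R]_d) : R :=
  \sum_(i < d) u 0 i * v 0 i.

(* The library norm `|u| on row vectors is the sup norm; it induces the same
   topology and the same differentiable functions as this Euclidean norm. *)
Definition norm2 (R : realType) (d : nat) (u : 'rV[R]_d) : R :=
  Num.sqrt (dot u u).

Definition gradient (R : realType) (d : nat) (f : 'rV[R]_d -> R)
    (x : 'rV[R]_d) : 'rV[R]_d :=
  \row_(i < d) 'D_(delta_mx 0 i) f x.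

Definition lipschitz_smooth (R : realType) (d : nat) (L : R)
    (f : 'rV[R]_d -> R) : Prop :=
  (forall x, differentiable f x) /\
  (forall x y, f y <= f x + dot (gradient f x) (y - x)
                      + L / 2 * norm2 (y - x) ^+ 2).

Definition strongly_convex (R : realType) (d : nat) (m : R)
    (f : 'rV[R]_d -> R) : Prop :=
  [/\ forall x, differentiable f x,
      continuous (gradient f) &
      forall x y, f x + dot (gradient f x) (y - x)
                  + m / 2 * norm2 (y - x) ^+ 2 <= f y].

Definition armijo (R : realType) (d : nat) (f : 'rV[R]_d -> R) (c : R)
    (x dir : 'rV[R]_d) (a : R) : Prop :=
  f (x + a *: dir) - f x <= c * a * dot (gradient f x) dir.

(* For dir = - gradient f x and 0 < a the denominator vanishes only when
   gradient f x = 0; then the Armijo condition holds and the backtracking loop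
   never evaluates this ratio. *)
Definition violation (R : realType) (d : nat) (f : 'rV[R]_d -> R) (c : R)
    (x dir : 'rV[R]_d) (a : R) : R :=
  (f (x + a *: dir) - f x) / (c * a * dot (gradient f x) dir).

Definition rho_hat (R : realType) (c eps rho v : R) : R :=
  Num.max eps (rho * ((1 - c) / (1 - c * v))).

(* Big-step semantics of the while loop: abls f c eps rho x dir a b means that
   the loop started at the tentative step-size a terminates and returns b. *)
Inductive abls (R : realType) (d : nat) (f : 'rV[R]_d -> R) (c eps rho : R)
    (x dir : 'rV[R]_d) : R -> R -> Prop :=
| abls_return (a : R) :
    armijo f c x dir a -> abls f c eps rho x dir a a
| abls_shrink (a b : R) :
    ~ armijo f c x dir a ->
    abls f c eps rho x dir (rho_hat c eps rho (violation f c x dir a) * a) b ->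
    abls f c eps rho x dir a b.

Inductive abls_variant : Type := Memoryless | Monotone.

Definition tentative_step (R : realType) (var : abls_variant) (a_in : R)
    (alpha : nat -> R) (k : nat) : R :=
  match var, k with
  | Monotone, j.+1 => alpha j
  | _, _ => a_in
  end.

Definition gradient_descent_abls (R : realType) (d : nat)
    (f : 'rV[R]_d -> R) (c eps rho a_in : R) (var : abls_variant)
    (x : nat -> 'rV[R]_d) (alpha : nat -> R) : Prop :=
  forall k : nat,
    abls f c eps rho (x k) (- gradient f (x k))
         (tentative_step var a_in alpha k) (alpha k) /\
    x k.+1 = x k - alpha k *: gradient f (x k).

(* Main.v *)
(** Each Armijo step decreases [f] by at least [c a |g|^2], where [g] is the
    gradient, and strong convexity gives [|g|^2 >= 2 m (f - f xstar)]; since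
    [2 c >= 1] the gap contracts by [1 - m a].  A rejected step-size [a]
    satisfies [1 - c v <= L a / 2] by smoothness, so shrinking it never goes
    below [rho * (2 (1 - c) / L)]; hence all steps are at least
    [min a_in (rho * a_bar)], also in the monotone variant.  The initial gap is
    at most [L / 2 * |x 0 - xstar|^2] because the gradient vanishes at [xstar]. *)

Require Import Defs.
From HB Require Import structures.
From mathcomp Require Import all_boot all_order all_algebra.
From mathcomp Require Import all_classical all_reals all_analysis.
From mathcomp Require Import ring lra.

Set Implicit Arguments.
Unset Strict Implicit.
Unset Printing Implicit Defensive.

Import Order.TTheory GRing.Theory Num.Theory.
Import numFieldNormedType.Exports.

Local Open Scope ring_scope.

Lemma dotC (R : realType) (d : nat) (u v : 'rV[R]_d) : dot u v = dot v u.
Proof. by apply: eq_bigr => i _; rewrite mulrC. Qed.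

Lemma dotDr (R : realType) (d : nat) (u v w : 'rV[R]_d) :
  dot u (v + w) = dot u v + dot u w.
Proof. by rewrite -big_split; apply: eq_bigr => i _; rewrite !mxE mulrDr. Qed.

Lemma dotZr (R : realType) (d : nat) (a : R) (u v : 'rV[R]_d) :
  dot u (a *: v) = a * dot u v.
Proof. by rewrite mulr_sumr; apply: eq_bigr => i _; rewrite !mxE mulrCA. Qed.

Lemma dotNr (R : realType) (d : nat) (u v : 'rV[R]_d) : dot u (- v) = - dot u v.
Proof. by rewrite -scaleN1r dotZr mulN1r. Qed.

Lemma dot_ge0 (R : realType) (d : nat) (u : 'rV[R]_d) : 0 <= dot u u.
Proof. by apply: sumr_ge0 => i _; rewrite -expr2 sqr_ge0. Qed.

Lemma dot_eq0 (R : realType) (d : nat) (u : 'rV[R]_d) : dot u u = 0 -> u = 0.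
Proof.
move=> u0; apply/rowP => i; rewrite mxE; apply/eqP; rewrite -sqrf_eq0 expr2.
apply/eqP; apply: (psumr_eq0P _ u0) => // j _.
by rewrite -expr2 sqr_ge0.
Qed.

Lemma sqr_norm2 (R : realType) (d : nat) (u : 'rV[R]_d) :
  norm2 u ^+ 2 = dot u u.
Proof. by rewrite sqr_sqrtr ?dot_ge0. Qed.

Lemma dot_addZ (R : realType) (d : nat) (a : R) (u v : 'rV[R]_d) :
  dot (u + a *: v) (u + a *: v) = dot u u + 2 * a * dot u v + a ^+ 2 * dot v v.
Proof.
rewrite dotDr dotZr (dotC (u + _) u) (dotC (u + _) v) !(dotDr, dotZr).
by rewrite (dotC v u); ring.
Qed.

(** The smoothness bound at the point reached by the step: the linear term is [- a] times the
    squared gradient, the quadratic one [L / 2 * a ^+ 2] times it. *)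
Lemma smooth_gradient_step (R : realType) (d : nat) (L : R)
    (f : 'rV[R]_d -> R) (x : 'rV[R]_d) (a : R) :
  lipschitz_smooth L f ->
  f (x + a *: - gradient f x) - f x
    <= (L * a / 2 - 1) * a * dot (gradient f x) (gradient f x).
Proof.
move=> [_ /(_ x (x + a *: - gradient f x))].
rewrite [x + _ - x]addrAC subrr add0r sqr_norm2 !dotZr.
rewrite (dotC (a *: _)) dotZr !dotNr (dotC (- _)) dotNr; lra.
Qed.

(** A step of size [L^-1] from [z] lowers [f] by at least [G / (2 L)], with [G] the squared
    gradient; minimality forces [G = 0]. *)
Lemma smooth_gradient_min (R : realType) (d : nat) (L : R)
    (f : 'rV[R]_d -> R) (z : 'rV[R]_d) :
  0 < L -> lipschitz_smooth L f -> (forall y, f z <= f y) -> gradient f z = 0.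
Proof.
move=> L0 fL zmin; apply: dot_eq0; apply/eqP.
rewrite eq_le dot_ge0 andbT.
have := smooth_gradient_step z (L^-1) fL.
have := zmin (z + L^-1 *: - gradient f z).
rewrite mulfV ?gt_eqF // => h1 h2.
have iL0 : 0 < L^-1 by rewrite invr_gt0.
set G := dot _ _ in h2 *.
have : L^-1 * G <= 0 by lra.
by rewrite pmulr_rle0.
Qed.

Lemma smooth_gap_le (R : realType) (d : nat) (L : R)
    (f : 'rV[R]_d -> R) (x z : 'rV[R]_d) :
  0 < L -> lipschitz_smooth L f -> (forall y, f z <= f y) ->
  f x - f z <= L / 2 * norm2 (x - z) ^+ 2.
Proof.
move=> L0 fL zmin; have [_ /(_ z x)] := fL.
(* Writing the zero gradient as [0 *: 0] lets [dotZr] remove the linear term. *)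
rewrite (smooth_gradient_min L0 fL zmin) dotC -(scale0r (0 : 'rV_d)) dotZr mul0r.
lra.
Qed.

(** The Polyak-Łojasiewicz inequality, by completing the square: expand [0 <= |g + m (z - x)|^2]
    with [g] the gradient at [x]. *)
Lemma strongly_convex_gap_le (R : realType) (d : nat) (m : R)
    (f : 'rV[R]_d -> R) (x z : 'rV[R]_d) :
  0 < m -> strongly_convex m f ->
  2 * m * (f x - f z) <= dot (gradient f x) (gradient f x).
Proof.
move=> m0 [_ _ /(_ x z)]; rewrite sqr_norm2.
have := dot_ge0 (gradient f x + m *: (z - x)); rewrite dot_addZ.
move: (dot _ (z - x)) (dot (z - x) _) (dot _ _) => P Q G h1 h2.
have : 0 <= m * (f z - (f x + P + m / 2 * Q)) by rewrite mulr_ge0 ?subr_ge0 // ltW.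
by nra.
Qed.

Lemma not_armijo_shrink (R : realType) (d : nat) (f : 'rV[R]_d -> R)
    (L c eps rho : R) (x : 'rV[R]_d) (a : R) :
  let a' := rho_hat c eps rho (violation f c x (- gradient f x) a) * a in
  0 < L -> lipschitz_smooth L f -> 0 < eps < 1 -> 0 < rho < 1 -> 0 < c < 1 ->
  0 < a -> ~ armijo f c x (- gradient f x) a ->
  [/\ 0 < a', a' <= a & rho * (2 * (1 - c) / L) <= a'].
Proof.
move=> a' L0 fL /andP[e0 e1] /andP[r0 r1] /andP[c0 c1] a0 /negP.
rewrite -ltNge dotNr; have := smooth_gradient_step x a fL.
rewrite {}/a' /rho_hat /violation dotNr.
set D := f _ - f x; set G := dot _ _ => smo nar.
(* If [G = 0], smoothness gives [D <= 0] while the failed Armijo test gives [0 < D]. *)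
have G0 : 0 < G.
  rewrite lt_neqAle dot_ge0 andbT; apply/eqP => G0.
  by move: smo nar; rewrite -G0 oppr0 !mulr0 => /le_lt_trans h /h; rewrite ltxx.
have aG0 : 0 < a * G by rewrite mulr_gt0.
set r := 1 - c * _.
(* Clears the division: [r] is [1 + D / (a G)]. The failed test then bounds [r] from below and
   smoothness bounds it from above. *)
have rE : r * (a * G) = a * G + D.
  by rewrite /r; field; rewrite ?oppr_eq0 !gt_eqF.
have r_gt : 1 - c < r by rewrite -(ltr_pM2r aG0) rE; lra.
have r_le : r <= L * a / 2 by rewrite -(ler_pM2r aG0) rE; lra.
have rp : 0 < r by lra.
have s0 : 0 < (1 - c) / r by rewrite divr_gt0 //; lra.
have s1 : (1 - c) / r <= 1 by rewrite ler_pdivrMr // mul1r ltW.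
split.
- by rewrite mulr_gt0 // lt_max e0.
- rewrite -[leRHS]mul1r ler_pM2r // ge_max ltW //=; nra.
(* The second branch of the maximum suffices: with [s = (1 - c) / r],
   [s * (L a / 2) >= s * r = 1 - c]. *)
- apply: (@le_trans _ _ (rho * ((1 - c) / r) * a)); last first.
    by rewrite ler_pM2r // le_max lexx orbT.
  have sE : (1 - c) / r * r = 1 - c by rewrite divfK ?gt_eqF.
  have slack : 0 <= (1 - c) / r * (L * a / 2 - r) by rewrite mulr_ge0 ?subr_ge0 // ltW.
  by rewrite -[leRHS]mulrA ler_pM2l // ler_pdivrMr //; lra.
Qed.

Lemma abls_bounds (R : realType) (d : nat) (f : 'rV[R]_d -> R)
    (L c eps rho : R) (x : 'rV[R]_d) (a b : R) :
  0 < L -> lipschitz_smooth L f -> 0 < eps < 1 -> 0 < rho < 1 -> 0 < c < 1 ->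
  abls f c eps rho x (- gradient f x) a b -> 0 < a ->
  [/\ armijo f c x (- gradient f x) b, 0 < b, b <= a &
      Num.min a (rho * (2 * (1 - c) / L)) <= b].
Proof.
move=> L0 fL e01 r01 c01; elim=> {a b} [a arm a0|a b narm _ IH a0].
  by split; rewrite // ge_min lexx.
have [a'0 a'a lea'] := not_armijo_shrink L0 fL e01 r01 c01 a0 narm.
have [arm b0 ba' minb] := IH a'0; split=> //; first exact: le_trans a'a.
(* The shrunk step is still above the floor, so restarting from it cannot lower the bound. *)
by apply: le_trans minb; rewrite le_min !ge_min lea' lexx !orbT.
Qed.

(** Induction serves the monotone variant: the previous step, positive and above the bound, is the
    next tentative one. *)
Lemma gradient_descent_step_bounds (R : realType) (d : nat) (f : 'rV[R]_d -> R)
    (L c eps rho a_in : R) (var : abls_variant)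
    (x : nat -> 'rV[R]_d) (alpha : nat -> R) :
  0 < L -> lipschitz_smooth L f -> 0 < eps < 1 -> 0 < rho < 1 -> 0 < c < 1 ->
  0 < a_in -> gradient_descent_abls f c eps rho a_in var x alpha ->
  forall k, [/\ armijo f c (x k) (- gradient f (x k)) (alpha k), 0 < alpha k &
                Num.min a_in (rho * (2 * (1 - c) / L)) <= alpha k].
Proof.
move=> L0 fL e01 r01 c01 ain0 gd.
have step k := abls_bounds L0 fL e01 r01 c01 (gd k).1.
elim=> [|k [_ ak0 ak]].
  have t0 : tentative_step var a_in alpha 0 = a_in by case: var {gd step}.
  by have := step 0%N; rewrite t0 => /(_ ain0)[].
move: (step k.+1); case: var {gd step} => /= step.
  by have [] := step ain0.
have [arm b0 _ minb] := step ak0; split=> //.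
by apply: le_trans minb; rewrite le_min ak ge_min lexx orbT.
Qed.

Lemma armijo_contraction (R : realType) (d : nat) (f : 'rV[R]_d -> R)
    (m c : R) (x z : 'rV[R]_d) (a : R) :
  0 < m -> strongly_convex m f -> 1 / 2 <= c -> 0 < a -> f z <= f x ->
  armijo f c x (- gradient f x) a ->
  f (x - a *: gradient f x) - f z <= (1 - m * a) * (f x - f z).
Proof.
move=> m0 fm c_ge a0 zx; rewrite /armijo dotNr scalerN => arm.
have gap := strongly_convex_gap_le x z m0 fm.
(* Here [c >= 1 / 2] turns the Armijo decrease into at least half of [a |g|^2]; [h2] converts that
   half into [m a] times the gap. *)
have h1 : 0 <= (c - 1 / 2) * (a * dot (gradient f x) (gradient f x)).
  by rewrite mulr_ge0 ?subr_ge0 // mulr_ge0 ?dot_ge0 // ltW.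
have h2 : 0 <= a * (dot (gradient f x) (gradient f x) - 2 * m * (f x - f z)).
  by rewrite mulr_ge0 ?subr_ge0 // ltW.
lra.
Qed.

Theorem proposition14 (R : realType) (d : nat) (f : 'rV[R]_d -> R)
    (L m : R) (xstar : 'rV[R]_d)
    (c eps rho a_in : R) (var : abls_variant)
    (x : nat -> 'rV[R]_d) (alpha : nat -> R)
    (L_gt0 : 0 < L) (m_gt0 : 0 < m)
    (f_smooth : lipschitz_smooth L f) (f_convex : strongly_convex m f)
    (xstar_min : forall y, f xstar <= f y)
    (eps_gt0 : 0 < eps) (eps_lt_rho : eps < rho) (rho_lt1 : rho < 1)
    (c_ge : 1 / 2 <= c) (c_lt1 : c < 1)
    (a_in_gt0 : 0 < a_in) (a_in_lt : a_in < 1 / m)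
    (descent : gradient_descent_abls f c eps rho a_in var x alpha) :
  let a_bar := 2 * (1 - c) / L in
  let q := m / L in
  (forall k : nat,
     f (x k) - f xstar
       <= (1 - m * Num.min a_in (rho * a_bar)) ^+ k
          * ((L + m) / 2) * norm2 (x 0%N - xstar) ^+ 2) /\
  (c = 1 / 2 -> rho / L < a_in ->
   forall k : nat,
     f (x k) - f xstar
       <= (1 - rho * q) ^+ k * ((L + m) / 2) * norm2 (x 0%N - xstar) ^+ 2).
Proof.
move=> a_bar q.
have rho01 : 0 < rho < 1 by rewrite rho_lt1 (lt_trans eps_gt0).
have eps01 : 0 < eps < 1 by rewrite eps_gt0 (lt_trans eps_lt_rho).
have c01 : 0 < c < 1 by rewrite c_lt1 andbT; lra.
have rate k : f (x k) - f xstar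
    <= (1 - m * Num.min a_in (rho * a_bar)) ^+ k
       * ((L + m) / 2) * norm2 (x 0%N - xstar) ^+ 2.
  set mu := Num.min _ _.
  (* From [mu <= a_in < 1 / m]; the sign is needed to multiply the induction hypothesis. *)
  have rate_ge0 : 0 <= 1 - m * mu.
    rewrite subr_ge0 mulrC -ler_pdivlMr //.
    by apply: le_trans (ltW a_in_lt); rewrite ge_min lexx.
  elim: k => [|k IH].
    (* Smoothness alone gives the constant [L / 2]; the [m / 2] part is nonnegative slack. *)
    have := smooth_gap_le (x 0%N) L_gt0 f_smooth xstar_min.
    have := mulr_ge0 (ltW m_gt0) (sqr_ge0 (norm2 (x 0%N - xstar))).
    rewrite expr0; lra.
  have [arm ak0 mu_le] := gradient_descent_step_bounds
    L_gt0 f_smooth eps01 rho01 c01 a_in_gt0 descent k.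
  rewrite (descent k).2 exprS -2!(mulrA (1 - m * mu)).
  apply: le_trans (armijo_contraction m_gt0 f_convex c_ge ak0
    (xstar_min _) arm) _.
  (* Replacing [alpha k] by the smaller [mu] weakens the factor, as the gap is nonnegative. *)
  apply: le_trans (_ : (1 - m * mu) * (f (x k) - f xstar) <= _).
    by rewrite ler_wpM2r ?subr_ge0 // lerD2l lerN2 ler_pM2l.
  exact: ler_wpM2l.
split=> // c_half a_in_gt k.
suff -> : rho * q = m * Num.min a_in (rho * a_bar) by [].
have -> : rho * a_bar = rho / L.
  by rewrite /a_bar c_half; field; rewrite gt_eqF.
by rewrite (min_idPr (ltW a_in_gt)) /q; ring.
Qed.
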